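(* Let $k,d\in\mathbb{N}$, let $A=\{a_1,\dots,a_d\}\subset\mathbb{Z}^k$ be a finite (nonempty) set of $d$ points, and let $P\subset\mathbb{R}^k$ be the convex hull of $A$. Let $$V(A)=\bigcup_{F} p_F^{-1}(\nabla_F)\subset\mathbb{C}^A,$$ where $F$ runs over all nonempty faces of $P$ (including $F=P$), $\nabla_F\subset\mathbb{C}^{F\cap A}$ is the (not closed up) discriminant locus of the face $F$, and $p_F:\mathbb{C}^A\to\mathbb{C}^{F\cap A}$ is the coordinate projection. Let $E_A$ be the principal $A$-determinant, and let $V(E_A)\subset\mathbb{C}^A$ be its zero locus. Then $$V(A)=\overline{V(A)}=V(E_A),$$ where $\overline{V(A)}$ is the Zariski closure of $V(A)$ in $\mathbb{C}^A$.
   Context: Notation: $x^{a}=x_1^{a_{1}}\cdots x_k^{a_{k}}$ for $a\in\mathbb{Z}^k$. Points of $\mathbb{C}^A$ are written $\alpha=(\alpha_i)_{i=1,\dots,d}$, with $\alpha_i$ the coordinate at $a_i$. Discriminant loci. For a nonempty face $F$ of $P$ and $\alpha\in\mathbb{C}^{F\cap A}$ put $f^F_\alpha=\sum_{a_i\in F}\alpha_i x^{a_i}\in\mathbb{C}[x_1^{\pm1},\dots,x_k^{\pm1}]$. Then $\nabla_F\subset\mathbb{C}^{F\cap A}$ is the set of all $\alpha$ such that there is a point $u\in(\mathbb{C}^* )^k$ with $f^F_\alpha(u)=0$ and $(\partial_i f^F_\alpha)(u)=0$ for all $i=1,\dots,k$, where $\partial_i=\partial/\partial x_i$. No closure is taken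 in the definition of $\nabla_F$. The Zariski closure $\overline{\nabla}_F$ is known to be irreducible with $\dim\overline{\nabla}_F<|F\cap A|$. The polynomials $\Delta_F$. If $\overline{\nabla}_F$ is a hypersurface in $\mathbb{C}^{F\cap A}$ (i.e. $\dim\overline{\nabla}_F=|F\cap A|-1$), then $\Delta_F$ is its defining equation (an irreducible polynomial, unique up to a nonzero scalar); otherwise $\Delta_F=1$. The composition $\Delta_F\circ p_F:\mathbb{C}^A\to\mathbb{C}$ is also denoted $\Delta_F$. Principal $A$-determinant (as defined in the book of Gelfand–Kapranov–Zelevinsky, ''Discriminants, Resultants and Multidimensional Determinants''). Identify the affine lattice generated by $A$ with $\mathbb{Z}^m$, so that $A\subset\mathbb{Z}^m$ affinely generates $\mathbb{Z}^m$. The $A$-resultant $R_A(f_0,\dots,f_m)$ is the irreducible polynomial (unique up to scalar) in the coefficients of $m+1$ Laurent polynomials $f_0,\dots,f_m\in\mathbb{C}^A$ with support in $A$ whose zero locus is the Zariski closure of the set of tuples $(f_0,\dots,f_m)$ having a common zero in $(\mathbb{C}^* )^m$. For $f=\sum_i\alpha_i x^{a_i}$ in $m$ variables, one sets $E_A(f)=R_A\bigl(x_1\tfrac{\partial f}{\partial x_1},\dots,x_m\tfrac{\partial f}{\partial x_m},f\bigr)$, a polynomial function of $\alpha\in\mathbb{C}^A$. Known theorem of Gelfand–Kapranov–Zelevinsky (from the same book): up to a nonzero scalar, $E_A=\prod_{F\subseteq P}\Delta_F^{m_F}$, the product over the nonempty faces $F$ of $P$ (including $P$), with suitable multiplicities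 $m_F\ge1$. Consequently $V(E_A)=\bigcup_{F}V(\Delta_F)$, with $V(\Delta_F)=\emptyset$ when $\Delta_F=1$. *)

(* Defs.v *)
From HB Require Import structures.
From mathcomp Require Import all_boot all_order all_algebra.
From mathcomp Require Import boolp classical_sets functions reals.
From mathcomp Require Import complex.
From mathcomp.multinomials Require Import freeg mpoly.

Set Implicit Arguments.
Unset Strict Implicit.
Unset Printing Implicit Defensive.

Import Order.TTheory GRing.Theory Num.Theory.

Local Open Scope classical_set_scope.
Local Open Scope ring_scope.

(* The complex numbers are [R[i]] for an arbitrary [R : realType]; a finite set
   {a_1, ..., a_d} of points of Z^k is an (injective) family
   [a : 'I_d -> 'rV[int]_k], and C^A is ['I_d -> R[i]]. *)

Section Laurent.
Context {R : realType}.
Local Notation C := R[i].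

(* C[x_1^{+-1}, ..., x_k^{+-1}] as the free C-module on Z^k, the basis element
   [<< b >>] being the monomial x^b. The operations below are the linear
   extensions ([fglift]) of their values on monomials. *)
Definition laurent (k : nat) := {freeg 'rV[int]_k / C}.

Definition torus (k : nat) : set ('I_k -> C) := [set u | forall j, u j != 0].

Definition leval (k : nat) (f : laurent k) (u : 'I_k -> C) : C :=
  fglift (fun b : 'rV[int]_k => (\prod_(j < k) u j ^ b 0 j : C^o)) f.

Definition lderiv (k : nat) (j : 'I_k) (f : laurent k) : laurent k :=
  fglift (fun b : 'rV[int]_k =>
    (<< (b 0 j)%:~R *g b - delta_mx 0 j >> : laurent k)) f.

(* multiplication by the variable x_j *)
Definition lmulX (k : nat) (j : 'I_k) (f : laurent k) : laurent k :=
  fglift (fun b : 'rV[int]_k => (<< b + delta_mx 0 j >> : laurent k)) f.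

Definition laurent_of (k : nat) (I : finType) (a : I -> 'rV[int]_k)
    (alpha : I -> C) : laurent k :=
  \sum_i << alpha i *g a i >>.

End Laurent.

Section Zariski.
Context {R : realType}.
Local Notation C := R[i].

Definition zero_locus (n : nat) (p : {mpoly C[n]}) : set ('I_n -> C) :=
  [set v | p.@[v] = 0].

Definition zariski_closure (n : nat) (S : set ('I_n -> C)) : set ('I_n -> C) :=
  [set v | forall p : {mpoly C[n]}, S `<=` zero_locus p -> zero_locus p v].

Definition irreducible_mpoly (n : nat) (p : {mpoly C[n]}) : Prop :=
  [/\ p != 0, p \isn't a GRing.unit &
    forall q r : {mpoly C[n]}, p = q * r ->
      q \is a GRing.unit \/ r \is a GRing.unit].

End Zariski.

Section Faces.
Context (R : realType) (k d : nat) (a : 'I_d -> 'rV[int]_k).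

Definition real_point (b : 'rV[int]_k) : 'rV[R]_k := map_mx intr b.

Definition newton_polytope : set 'rV[R]_k :=
  [set x | exists w : 'I_d -> R,
     [/\ forall i, 0 <= w i, \sum_i w i = 1
       & x = \sum_i w i *: real_point (a i)]].

(* Faces are the intersections with supporting hyperplanes; the zero functional
   gives the whole polytope. *)
Definition is_face (P F : set 'rV[R]_k) : Prop :=
  exists (l : 'cV[R]_k) (c : R),
    (forall x, P x -> (x *m l) 0 0 <= c) /\
    F = P `&` [set x | (x *m l) 0 0 = c].

Definition nonempty_face (F : set 'rV[R]_k) : Prop :=
  is_face newton_polytope F /\ F !=set0.

(* the (indices of the) elements of A lying on F *)
Definition face_index (F : set 'rV[R]_k) : finType :=
  {i : 'I_d | `[< F (real_point (a i)) >]}.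

Definition face_proj (F : set 'rV[R]_k) (alpha : 'I_d -> R[i]) :
    face_index F -> R[i] :=
  fun i => alpha (val i).

Definition nabla (F : set 'rV[R]_k) : set (face_index F -> R[i]) :=
  [set alpha | exists2 u : 'I_k -> R[i], torus u &
     let f := laurent_of (fun i : face_index F => a (val i)) alpha in
     leval f u = 0 /\ forall j : 'I_k, leval (lderiv j f) u = 0].

Definition discriminant_union : set ('I_d -> R[i]) :=
  \bigcup_(F in nonempty_face) (@face_proj F @^-1` @nabla F).

End Faces.

Arguments discriminant_union R {k d} a.

Section PrincipalDeterminant.
Context {R : realType}.
Local Notation C := R[i].

Definition affine_lattice (k d : nat) (a : 'I_d -> 'rV[int]_k) :
    set 'rV[int]_k :=
  [set x | exists2 n : 'I_d -> int, \sum_i n i = 1 & x = \sum_i n i *: a i].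

(* [b] is the family [a] read in Z^m through an affine isomorphism
   y |-> y M + c from Z^m onto the affine lattice generated by [a]. *)
Definition lattice_coordinates (k d : nat) (a : 'I_d -> 'rV[int]_k)
    (m : nat) (b : 'I_d -> 'rV[int]_m) : Prop :=
  exists (M : 'M[int]_(m, k)) (c : 'rV[int]_k),
    let phi := fun y : 'rV[int]_m => y *m M + c in
    [/\ injective phi, range phi = affine_lattice a
      & forall i, phi (b i) = a i].

(* A tuple (f_0, ..., f_m) of elements of C^A is a point of C^((m+1)d), the
   coefficient of f_i at the j-th point having index [mxvec_index i j]. *)
Definition tuple_point (m d : nat) (t : 'I_m.+1 -> 'I_d -> C) :
    'I_(m.+1 * d) -> C :=
  fun l => mxvec (\matrix_(i < m.+1, j < d) t i j) 0 l.

Definition common_zero_tuples (m d : nat) (b : 'I_d -> 'rV[int]_m) :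
    set ('I_(m.+1 * d) -> C) :=
  [set tuple_point t | t in
    [set t | exists2 u : 'I_m -> C, torus u &
       forall i : 'I_m.+1, leval (laurent_of b (t i)) u = 0]].

Definition is_A_resultant (m d : nat) (b : 'I_d -> 'rV[int]_m)
    (r : {mpoly C[m.+1 * d]}) : Prop :=
  irreducible_mpoly r /\
  zero_locus r = zariski_closure (common_zero_tuples b).

(* (x_1 df/dx_1, ..., x_m df/dx_m, f), the last index giving f *)
Definition log_derivatives (m : nat) (f : @laurent R m) (i : 'I_m.+1) :
    laurent m :=
  if unlift ord_max i is Some j then lmulX j (lderiv j f) else f.

(* E_A depends on the choice of the resultant (up to a scalar) and of the
   identification of the lattice with Z^m: all the choices are allowed. *)
Definition is_principal_A_determinant (k d : nat) (a : 'I_d -> 'rV[int]_k)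
    (E : {mpoly C[d]}) : Prop :=
  exists (m : nat) (b : 'I_d -> 'rV[int]_m) (r : {mpoly C[m.+1 * d]}),
    [/\ lattice_coordinates a b, is_A_resultant b r
      & forall alpha : 'I_d -> C,
          E.@[alpha] =
          r.@[tuple_point (fun i j =>
                coeff (b j) (log_derivatives (laurent_of b alpha) i))]].

End PrincipalDeterminant.

(* Main.v *)
Require Import Defs.
From HB Require Import structures.
From mathcomp Require Import all_boot all_order all_algebra.
From mathcomp Require Import boolp classical_sets functions reals.
From mathcomp Require Import complex.
From mathcomp.multinomials Require Import freeg mpoly.
From mathcomp Require Import ring zify.
Import Order.TTheory GRing.Theory Num.Theory.
Local Open Scope classical_set_scope.
Local Open Scope ring_scope.

(* Let X be the affine cone over the projective toric variety of A, cut out by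
   binomials. By convex duality over Z and divisibility of C^*, its nonzero
   points are exactly the points (s u^(a_i)) on a face, extended by 0 off the
   face. Hence V(A) is the set of alpha such that the k + 1 linear equations
   sum_i alpha_i z_i = 0 and sum_i alpha_i a_i z_i = 0 have a nonzero solution
   z in X, and it is closed by the main theorem of elimination theory. In the
   same way the closure of the set of tuples with a common zero in the torus is
   the set of tuples whose linear equations have a nonzero solution in X: it is
   contained in this closed set, and conversely a solution on the orbit of a
   face is deformed into the open orbit along a one-parameter subgroup. Both
   conditions agree on the logarithmic derivatives of f, since X depends only
   on the affine relations of A. *)

Set Implicit Arguments.
Unset Strict Implicit.
Unset Printing Implicit Defensive.

(** * Elimination theory *)

(** The element [r] is the resultant. Under [ev], where [f] becomes the constant [c] and [g] keeps
    degree [e], the Sylvester matrix is triangular with nonzero diagonal. If [f] or [g] is itself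
    constant, its constant coefficient serves instead. *)
Lemma exists_elimination_element (B : comNzRingType) (K : fieldType)
    (ev : {rmorphism B -> K}) (f g : {poly B}) (e : nat) (c : K) :
  (size g <= e.+1)%N -> ev g`_e != 0 -> map_poly ev f = c%:P -> c != 0 ->
  exists r u v, ev r != 0 /\ r%:P = u * f + v * g.
Proof.
move=> sg nzg ff nzc; have sgE : size g = e.+1.
  apply/eqP; rewrite eqn_leq sg ltnNge /=; apply: contraNN nzg => sg'.
  by rewrite nth_default ?rmorph0.
have fE i : ev f`_i = c *+ (i == 0%N) by rewrite -coef_map ff coefC mulrb.
have [sf|sf] := leqP (size f) 1.
  exists f`_0, 1, 0; rewrite fE mulr1n; split=> //.
  by rewrite mul1r mul0r addr0 -size1_polyC.
case: e => [|e] in sg nzg sgE *.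
  by exists g`_0, 0, 1; rewrite mul1r mul0r add0r -size1_polyC.
have sg1 : (1 < size g)%N by rewrite sgE.
have [[u v] _ uv] := resultant_in_ideal sf sg1.
exists (resultant f g), u, v; split; last exact: uv.
rewrite /resultant -det_map_mx det_trig.
  apply/prodf_neq0 => i _; rewrite mxE Sylvester_mxE.
  case: splitP => k ->; first by rewrite leqnn subnn fE.
  by rewrite leq_addl addnK sgE mulr1n.
apply/is_trig_mxP => i j; rewrite mxE Sylvester_mxE.
case: splitP => k -> lt_j.
  by rewrite (ltnW lt_j) fE subn_eq0 leqNgt lt_j.
rewrite [_`_ _]nth_default ?mul0rn ?rmorph0 //.
by apply: leq_trans (leqSpred _) _; rewrite ltn_subRL addnC.
Qed.

(* [tower A n] is A[y_0, ..., y_(n-1)], with y_(n-1) as outermost variable. In a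
   point [y : nat -> K] only the first [n] coordinates matter, so that the same
   set of points serves for all [n]. *)
Fixpoint tower (A : comNzRingType) (n : nat) : comNzRingType :=
  if n is n'.+1 then {poly (tower A n')} else A.

Section Elimination.
Context (K : closedFieldType) (A : comNzRingType) (iota : {rmorphism K -> A}).
Context (T : Type) (phi : T -> {rmorphism A -> K}).
Hypothesis phi_iota : forall t c, phi t (iota c) = c.

Fixpoint teval (t : T) (y : nat -> K) (n : nat) : {rmorphism tower A n -> K} :=
  match n with
  | 0 => phi t
  | n'.+1 => horner_eval (y n') \o map_poly (teval t y n')
  end.

Fixpoint tconst (n : nat) : {rmorphism A -> tower A n} :=
  match n with
  | 0 => idfun
  | n'.+1 => polyC \o tconst n'
  end.

Fixpoint tvar (n i : nat) : tower A n :=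
  match n with
  | 0 => 0
  | n'.+1 => if i == n' then 'X else (tvar n' i)%:P
  end.

(** Applied to the coefficient of y_n^e, this gives the coefficient of the pure power y_n^e. *)
Fixpoint tcst0 (n : nat) : tower A n -> A :=
  match n with
  | 0 => id
  | n'.+1 => fun F : {poly tower A n'} => tcst0 F`_0
  end.

(* the homogeneous component of degree [e] in the variables y_i *)
Fixpoint hcomp (n e : nat) : tower A n -> tower A n :=
  match n with
  | 0 => fun F => if e == 0%N then F else 0
  | n'.+1 => fun F : {poly tower A n'} => \poly_(i < e.+1) hcomp (e - i) F`_i
  end.

Lemma tevalS t y n (F : {poly tower A n}) :
  teval t y n.+1 F = (map_poly (teval t y n) F).[y n].
Proof. by []. Qed.

Lemma tevalS_wide t y n m (F : {poly tower A n}) : (size F <= m)%N ->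
  teval t y n.+1 F = \sum_(i < m) teval t y n F`_i * y n ^+ i.
Proof.
move=> sF; rewrite tevalS (@horner_coef_wide _ m); last first.
  exact: leq_trans (size_poly _ _) sF.
by apply: eq_bigr => i _; rewrite coef_map.
Qed.

Lemma teval_ext t y y' n (F : tower A n) :
  (forall i, (i < n)%N -> y i = y' i) -> teval t y n F = teval t y' n F.
Proof.
elim: n F => [//|n IHn] F eqy; rewrite !(@tevalS_wide _ _ n (size F)) //.
apply: eq_bigr => i _; rewrite eqy // (IHn F`_i) // => j /ltnW lt_jn.
exact: eqy.
Qed.

Lemma teval_polyC t y n (F : tower A n) :
  teval t y n.+1 (F%:P : {poly tower A n}) = teval t y n F.
Proof. by rewrite tevalS map_polyC hornerC. Qed.

Lemma teval_const t y n p : teval t y n (tconst n p) = phi t p.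
Proof.
by elim: n => [//|n IHn]; apply: etrans (teval_polyC _ _ _) IHn.
Qed.

Lemma teval_var t y n i : (i < n)%N -> teval t y n (tvar n i) = y i.
Proof.
elim: n => [//|n IHn]; rewrite ltnS leq_eqVlt => lt_in.
rewrite [tvar _ _]/=; case: eqVneq lt_in => [-> _|_ /= lt_in].
  by rewrite tevalS map_polyX hornerX.
by apply: etrans (teval_polyC _ _ _) (IHn lt_in).
Qed.

Lemma teval_hcompS t y n e (F : {poly tower A n}) :
  teval t y n.+1 (hcomp (n := n.+1) e F) =
  \sum_(i < e.+1) teval t y n (hcomp (e - i) F`_i) * y n ^+ i.
Proof.
rewrite (@tevalS_wide _ _ _ e.+1) ?size_poly //.
by apply: eq_bigr => i _; rewrite coef_poly ltn_ord.
Qed.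

Lemma hcomp_scale t y c n e (F : tower A n) :
  teval t (fun i => c * y i) n (hcomp e F) = c ^+ e * teval t y n (hcomp e F).
Proof.
elim: n e F => [|n IHn] e F.
  by rewrite /=; case: eqP => [->|_]; rewrite ?mul1r // !rmorph0 mulr0.
rewrite !teval_hcompS mulr_sumr; apply: eq_bigr => i _.
have -> : c ^+ e = c ^+ (e - i) * c ^+ i.
  by rewrite -exprD subnK // -ltnS.
by rewrite IHn exprMn mulrACA.
Qed.

Lemma hcomp0 n e : hcomp e (0 : tower A n) = 0.
Proof.
elim: n e => [|n IHn] e /=; first by case: ifP.
by apply/polyP => i; rewrite coef_poly !coef0 IHn if_same.
Qed.

(** Every large [E] is allowed because, in the induction, the coefficients in the outer variable
    have different degrees. *)
Lemma hcomp_sum n (F : tower A n) : exists D, forall E, (D <= E)%N ->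
  forall t y, teval t y n F = \sum_(e < E) teval t y n (hcomp e F).
Proof.
elim: n F => [|n IHn] F.
  exists 1%N => -[//|E] _ t y; rewrite big_ord_recl big1 ?addr0 //.
  by move=> i _; rewrite /= rmorph0.
pose D i := projT1 (cid (IHn (F : {poly tower A n})`_i)).
have DP i : forall E, (D i <= E)%N -> forall t y,
  teval t y n (F : {poly tower A n})`_i =
    \sum_(e < E) teval t y n (hcomp e (F : {poly tower A n})`_i).
  exact: (projT2 (cid (IHn _))).
exists (size (F : {poly _}) + \sum_(i < size (F : {poly _})) D i)%N => E leE t y.
rewrite (@tevalS_wide _ _ _ E); last exact: leq_trans (leq_addr _ _) leE.
(* Regroup by total degree [e], of which [i] is carried by y_n. *)
transitivity (\sum_(e < E) \sum_(i < E | (i <= e)%N)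
    teval t y n (hcomp (e - i) (F : {poly tower A n})`_i) * y n ^+ i); last first.
  apply: eq_bigr => e _; rewrite teval_hcompS.
  by rewrite (big_ord_widen _ (fun i : nat => teval t y n
    (hcomp (e - i) (F : {poly tower A n})`_i) * y n ^+ i) (ltn_ord e)).
rewrite (exchange_big_dep xpredT) //=; apply: eq_bigr => i _.
rewrite -mulr_suml; congr (_ * _).
have [lt_iF|le_Fi] := ltnP i (size (F : {poly tower A n})); last first.
  rewrite nth_default // rmorph0 big1 // => e _.
  by rewrite hcomp0 rmorph0.
transitivity (\sum_(i <= e < E)
  teval t y n (hcomp (e - i) (F : {poly tower A n})`_i)); last first.
  by rewrite big_geq_mkord.
rewrite -[X in \sum_(X <= _ < _) _]add0n big_addn big_mkord.
under eq_bigr do rewrite addnK.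
apply: DP; rewrite leq_subRL; last exact: ltnW.
apply: leq_trans leE; apply: leq_add; first exact: ltnW.
by rewrite (bigD1 (Ordinal lt_iF)) //= leq_addr.
Qed.

(** Degree 0 is left for the other variables, so this coefficient does not depend on [y]. *)
Lemma hcomp_lead n e (F : {poly tower A n}) t y :
  teval t y n (hcomp (n := n.+1) e F : {poly tower A n})`_e =
  phi t (tcst0 (F : {poly tower A n})`_e).
Proof.
rewrite coef_poly ltnSn subnn; move: (_`_e) => {}F.
elim: n F => [//|n IHn] F.
by rewrite teval_hcompS big_ord1 subnn expr0 mulr1 IHn.
Qed.

Lemma hcomp_point n e (F : {poly tower A n}) t :
  teval t (fun i => (i == n)%:R) n.+1 (hcomp (n := n.+1) e F) =
  phi t (tcst0 (F : {poly tower A n})`_e).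
Proof.
rewrite teval_hcompS big_ord_recr /= subnn big1 ?add0r => [|i _].
  rewrite eqxx expr1n mulr1 -(@hcomp_lead _ _ _ _ (fun i => (i == n)%:R)).
  by rewrite coef_poly ltnSn subnn.
rewrite (@teval_ext _ _ (fun i => 0 * (i == n)%:R)) => [|j lt_jn].
  by rewrite hcomp_scale expr0n subn_eq0 leqNgt ltn_ord /= !mul0r.
by rewrite mul0r ltn_eqF.
Qed.

Lemma poly_eq0_closed (p : {poly K}) : (forall c, c != 0 -> p.[c] = 0) -> p = 0.
Proof.
move=> p0; apply/eqP/negPn/negP => nzp.
(* A root c of p X + 1 is nonzero, so p vanishes there too, giving 1 = 0. *)
have /closed_rootP[c] : size (p * 'X + 1) != 1%N.
  by rewrite size_polyDl size_mulX // ?size_poly1 ?eqSS ?ltnS ?lt0n size_poly_eq0.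
rewrite rootE !hornerE; have [->|/p0->] := eqVneq c 0; rewrite ?mulr0 ?mul0r.
  by rewrite add0r oner_eq0.
by rewrite add0r oner_eq0.
Qed.

Section Cone.
Variable Z : T -> (nat -> K) -> Prop.
Hypothesis coneZ : forall t y c, Z t y -> c != 0 -> Z t (fun i => c * y i).

Definition vanishing n (F : tower A n) :=
  forall t y, Z t y -> teval t y n F = 0.

Definition in_closure t n y :=
  forall F : tower A n, vanishing F -> teval t y n F = 0.

(** Along the line through a point of [Z], [F] is a polynomial in the scaling factor, with the
    values of its components as coefficients; it vanishes at every nonzero scalar. *)
Lemma vanishing_hcomp n e (F : tower A n) : vanishing F -> vanishing (hcomp e F).
Proof.
move=> F0 t y Zty; have [D DP] := hcomp_sum F.
pose E := maxn D e.+1; pose p := \poly_(e < E) teval t y n (hcomp e F).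
suff /polyP/(_ e) : p = 0 by rewrite coef_poly coef0 leq_maxr.
apply: poly_eq0_closed => c nzc; rewrite horner_poly.
rewrite -[RHS](F0 t _ (coneZ Zty nzc)) (DP E) ?leq_maxl //.
by apply: eq_bigr => i _; rewrite hcomp_scale mulrC.
Qed.

(* If no value of the new coordinate c worked, the ideal of the polynomials F(y, c)
   with F vanishing on Z would contain a nonzero constant; the resultant of such
   an F with g then vanishes on Z without vanishing at y. *)
Lemma in_closure_extend t y n e (g : {poly tower A n}) :
    @vanishing n.+1 g -> (size g <= e.+1)%N -> teval t y n g`_e != 0 ->
    in_closure t n y ->
  exists c, in_closure t n.+1 (fun i => if i == n then c else y i).
Proof.
move=> g0 sg nzg cl_y; pose ev := teval t y n.
(* [I] is an ideal of K[c], since [iota] lifts scalars to the tower. *)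
pose I (q : {poly K}) :=
  exists2 F : {poly tower A n}, @vanishing n.+1 F & map_poly ev F = q.
have IB q1 q2 q : I q1 -> I q2 -> I (q1 - q * q2).
  move=> [F1 F1_0 <-] [F2 F2_0 <-].
  exists (F1 - map_poly (tconst n \o iota) q * F2).
    by move=> t' y' Zy; rewrite rmorphB rmorphM F1_0 ?F2_0 // mulr0 subrr.
  rewrite rmorphB rmorphM /= -map_poly_comp; congr (_ - _ * _).
  rewrite -[RHS](@map_poly_id _ id) //; apply: eq_map_poly => x.
  by rewrite /= /ev teval_const phi_iota.
(* A nonzero element of least size generates [I]; any root of it is a suitable c. *)
pose S m := `[< exists q, [/\ I q, q != 0 & size q = m] >].
have exS : exists m, S m.
  exists (size (map_poly ev g)); apply/asboolP; exists (map_poly ev g).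
  split=> //; first by exists g.
  by apply: contraNneq nzg => /polyP/(_ e); rewrite coef0 coef_map => ->.
case: (ex_minnP exS) => m /asboolP[q [Iq nzq <-]] min_q {exS}.
have div_q p : I p -> q %| p.
  move=> Ip; rewrite /dvdp; apply: contraTT isT => nz_r.
  have := min_q (size (p %% q)); rewrite leqNgt ltn_modp nzq; apply.
  apply/asboolP; exists (p %% q); split=> //.
  suff -> : p %% q = p - (p %/ q) * q by apply: IB.
  by apply/eqP; rewrite eq_sym subr_eq addrC -divp_eq.
have [sq|/closed_rootP[c qc]] := eqVneq (size q) 1; last first.
  exists c => F F0; rewrite tevalS eqxx; apply/eqP.
  have -> : map_poly (teval t (fun i => if i == n then c else y i) n) F
            = map_poly ev F.
    apply: eq_map_poly => p; apply: teval_ext => i lt_in.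
    by rewrite ltn_eqF.
  rewrite -rootE -dvdp_XsubCl; apply: dvdp_trans (div_q _ _); last by exists F.
  by rewrite dvdp_XsubCl.
have [F F0 FE] := Iq; have /eqP/size_poly1P[c nzc qE] := sq.
rewrite qE in FE.
have [r [u [v [nzr rE]]]] := exists_elimination_element sg nzg FE nzc.
case/eqP: nzr; apply: cl_y => t' y' Zy; rewrite -teval_polyC rE.
by rewrite rmorphD !rmorphM F0 // g0 // !mulr0 addr0.
Qed.

(* The induction projects from the point (0, ..., 0, 1), which lies outside the
   closure of the fibre: this provides an equation of Z whose leading
   coefficient in the last variable is independent of the other y_i. *)
Theorem projective_elimination t0 n :
    (forall y i, (i < n)%N -> y i != 0 -> ~ in_closure t0 n y) ->
  exists2 p : A, phi t0 p != 0 &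
    forall t y i, Z t y -> (i < n)%N -> y i != 0 -> phi t p = 0.
Proof.
elim: n => [_|n IHn no_point].
  by exists 1; rewrite ?rmorph1 ?oner_eq0.
have [F [F0 nzF]] : exists F : {poly tower A n},
    @vanishing n.+1 F /\ teval t0 (fun i => (i == n)%:R) n.+1 F != 0.
  have /existsNP[F /not_implyP[F0 /eqP nzF]] :
      ~ in_closure t0 n.+1 (fun i => (i == n)%:R).
    by apply: (no_point _ n); rewrite ?eqxx ?oner_eq0.
  by exists F.
have [e nze] : exists e, phi t0 (tcst0 F`_e) != 0.
  have [D /(_ D (leqnn D)) DP] := hcomp_sum (n := n.+1) F.
  apply/not_existsP => all0; case/eqP: nzF; rewrite DP big1 // => e _.
  by rewrite hcomp_point; apply/eqP/negPn/negP/all0.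
(* A component of [F] that is nonzero at (0, ..., 0, 1): over [t0] its degree in y_n is exactly
   [e]. *)
pose g : {poly tower A n} := hcomp (n := n.+1) e F.
have g0 : @vanishing n.+1 g by apply: vanishing_hcomp.
have sg : (size g <= e.+1)%N by apply: size_poly.
have ge t y : teval t y n g`_e = phi t (tcst0 F`_e) by apply: hcomp_lead.
case: IHn => [y i lt_in nzy cl_y|p nzp p0].
  have nzg : teval t0 y n g`_e != 0 by rewrite ge.
  have [c] := in_closure_extend g0 sg nzg cl_y.
  by apply: (no_point _ i); [exact: leqW | rewrite ltn_eqF].
(* [p] handles the points with a nonzero coordinate among the first [n], the other factor the
   multiples of (0, ..., 0, 1). *)
exists (p * tcst0 F`_e); first by rewrite rmorphM mulf_neq0.
move=> t y i Zy lt_in nzy; rewrite rmorphM.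
have [[j /andP[lt_jn nzj]]|y0] :=
  pselect (exists j, (j < n)%N && (y j != 0)); first by rewrite (p0 t y j) ?mul0r.
have yj0 j : (j < n)%N -> y j = 0.
  by move=> lt_jn; apply/eqP/negPn/negP => nzj; apply: y0; exists j; apply/andP.
have nzyn : y n != 0.
  move: lt_in nzy; rewrite ltnS leq_eqVlt => /predU1P[->//|/yj0 ->].
  by rewrite eqxx.
have := g0 t y Zy; rewrite (@teval_ext _ _ (fun i => y n * (i == n)%:R)).
  rewrite hcomp_scale hcomp_point => /eqP.
  by rewrite mulf_eq0 expf_eq0 (negPf nzyn) andbF => /eqP ->; rewrite mulr0.
move=> j; rewrite ltnS leq_eqVlt; case: eqVneq => [->|_ /yj0 ->].
  by rewrite mulr1.
by rewrite mulr0.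
Qed.

End Cone.
End Elimination.

(** * Faces and integral relations *)

Section Alternative.
Context (I : eqType).

Definition dotz n (u v : 'rV[int]_n) : int := (u *m v^T) 0 0.

Lemma dotzC n (u v : 'rV[int]_n) : dotz u v = dotz v u.
Proof. by rewrite /dotz -[in LHS](trmxK u) -trmx_mul mxE. Qed.

Lemma dotzDl n (u v w : 'rV[int]_n) : dotz (u + v) w = dotz u w + dotz v w.
Proof. by rewrite /dotz mulmxDl mxE. Qed.

Lemma dotzZl n c (u w : 'rV[int]_n) : dotz (c *: u) w = c * dotz u w.
Proof. by rewrite /dotz -scalemxAl mxE. Qed.

Lemma dotzDr n (u v w : 'rV[int]_n) : dotz w (u + v) = dotz w u + dotz w v.
Proof. by rewrite !(dotzC w) dotzDl. Qed.

Lemma dotzZr n c (u w : 'rV[int]_n) : dotz w (c *: u) = c * dotz w u.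
Proof. by rewrite !(dotzC w) dotzZl. Qed.

Lemma dotz0 n (u : 'rV[int]_n) : dotz u 0 = 0.
Proof. by rewrite /dotz trmx0 mulmx0 mxE. Qed.

Lemma dotz_gt0 n (u : 'rV[int]_n) : (0 < dotz u u) = (u != 0).
Proof.
have uu : dotz u u = \sum_j (u 0 j) ^+ 2.
  by rewrite /dotz mxE; apply: eq_bigr => j _; rewrite mxE expr2.
have uu_ge0 : 0 <= dotz u u by rewrite uu sumr_ge0 // => j _; apply: sqr_ge0.
rewrite lt0r uu_ge0 andbT; congr (~~ _); apply/eqP/eqP => [|->].
  rewrite uu => /psumr_eq0P u0; apply/rowP => j; rewrite mxE.
  by apply/eqP; rewrite -sqrf_eq0 u0 // => l _; apply: sqr_ge0.
by rewrite dotz0.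
Qed.

Definition override (f : I -> int) i c x : int := if x == i then c else f x.

Lemma sum_override n (v : I -> 'rV[int]_n) f i c (s : seq I) : i \notin s ->
  \sum_(x <- s) override f i c x *: v x = \sum_(x <- s) f x *: v x.
Proof.
move=> i_s; apply: eq_big_seq => x x_s; rewrite /override.
by case: eqVneq => // xi; rewrite xi in x_s; rewrite x_s in i_s.
Qed.

(** An obstruction to a [y] with [dotz (v x) y] zero on [S] and positive on [T]: pairing the
    relation with [y] would make 0 positive. *)
Definition positive_relation n (v : I -> 'rV[int]_n) (S T : seq I) :=
  exists f : I -> int,
    [/\ {in T, forall x, 0 <= f x}, exists2 x, x \in T & 0 < f x
      & \sum_(x <- S ++ T) f x *: v x = 0].

(* Fourier-Motzkin style induction on [T], with integral multiples in place of
   quotients. *)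
Lemma gordan n (v : I -> 'rV[int]_n) (T : seq I) : uniq T ->
  (exists y, {in T, forall x, 0 < dotz (v x) y}) \/ positive_relation v [::] T.
Proof.
elim: T v => [|i T IHT] v /=; first by left; exists 0.
case/andP=> iT uT.
have neq_i x : x \in T -> (x == i) = false.
  by move=> xT; apply: contraNF iT => /eqP <-.
(* A solution on [T] orthogonal to [v i] suffices: add [v i] to a dominating multiple of it. If
   [v i] is 0, it is itself a relation. *)
have perturb y : dotz (v i) y = 0 -> {in T, forall x, 0 < dotz (v x) y} ->
    (exists y, {in i :: T, forall x, 0 < dotz (v x) y}) \/
    positive_relation v [::] (i :: T).
  move=> vy0 vy; have [v0|nzv] := eqVneq (v i) 0.
    right; exists (override (fun=> 0) i 1); split=> [x _||].
    - by rewrite /override; case: ifP.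
    - by exists i; rewrite ?mem_head // /override eqxx.
    - rewrite big_cons v0 scaler0 add0r sum_override // big1 // => x _.
      by rewrite scale0r.
  pose N := 1 + \sum_(x <- T) `|dotz (v x) (v i)|.
  left; exists (N *: y + v i) => x; rewrite inE => /predU1P[->|xT].
    by rewrite dotzDr dotzZr vy0 mulr0 add0r dotz_gt0.
  rewrite dotzDr dotzZr.
  have leN : `|dotz (v x) (v i)| < N.
    rewrite /N (big_rem x) //=; apply: (ltr_pwDl ltr01).
    by rewrite lerDl sumr_ge0.
  have N0 : 0 <= N by apply: le_trans (ltW leN).
  have : N <= N * dotz (v x) y by rewrite ler_peMr // -gtz0_ge1 vy.
  have : - `|dotz (v x) (v i)| <= dotz (v x) (v i) by rewrite lerNl ler_normr lexx orbT.
  lia.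
have [[y vy]|[f [f0 [x xT fx] sf]]] := IHT v uT; last first.
  right; exists (override f i 0); split.
  - move=> z; rewrite inE /override; case: ifP => //= _; exact: f0.
  - by exists x; rewrite ?inE ?xT ?orbT // /override neq_i.
  - by rewrite big_cons /override eqxx scale0r add0r sum_override.
set p := dotz (v i) y; have [p0|p0|p0] := ltgtP p 0; last exact: perturb vy.
  (* For [x] in [T], [w x] is a combination of [v i] and [v x] with positive weights, orthogonal to
     [y]. *)
  pose w x := dotz (v x) y *: v i - p *: v x.
  have [[y' wy]|[f [f0 [x xT fx] sf]]] := IHT w uT.
    (* This vector is orthogonal to [v i] and pairs with [v x] as [y'] does with [w x]. *)
    apply: (perturb ((- p) *: y' + dotz (v i) y' *: y)) => [|x xT].
      rewrite dotzDr !dotzZr -/p; ring.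
    have := wy x xT; rewrite dotzDl -scaleNr !dotzZl dotzDr !dotzZr.
    lia.
  right; exists (override (fun x => - p * f x) i (\sum_(x <- T) f x * dotz (v x) y)).
  have f'0 z : z \in T -> 0 <= - p * f z.
    by move=> zT; rewrite mulr_ge0 ?f0 // oppr_ge0 ltW.
  split.
  - move=> z; rewrite inE /override; case: ifP => //= _; last exact: f'0.
    move=> _; rewrite big_seq sumr_ge0 // => x' x'T.
    by rewrite mulr_ge0 ?f0 // ltW // vy.
  - exists x; rewrite ?inE ?xT ?orbT // /override neq_i //.
    by rewrite mulr_gt0 // oppr_gt0.
  - rewrite big_cons sum_override // /override eqxx -[RHS]sf scaler_suml -big_split.
    apply: eq_bigr => z _ /=; rewrite /w scalerBr !scalerA -scaleNr.
    by congr (_ + _ *: _); ring.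
by left; exists y => x; rewrite inE => /predU1P[->|/vy].
Qed.

(** Equalities are removed one at a time by projecting orthogonally to [v s], scaled by its squared
    norm to stay integral; Gordan's alternative remains. *)
Lemma motzkin_alternative n (v : I -> 'rV[int]_n) (S T : seq I) :
    uniq (S ++ T) ->
  (exists y, {in S, forall x, dotz (v x) y = 0} /\
             {in T, forall x, 0 < dotz (v x) y})
  \/ positive_relation v S T.
Proof.
elim: S v => [|s S IHS] v /=.
  by move=> /gordan-/(_ n v)[[y vy]|]; [left; exists y | right].
case/andP=> sST uST.
have neq_s x : x \in T -> (x == s) = false.
  by move=> xT; apply: contraNF sST => /eqP <-; rewrite mem_cat xT orbT.
have [v0|nzv] := eqVneq (v s) 0.
  case: (IHS v uST) => [[y [vS vT]]|[f [f0 f1 sf]]].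
    left; exists y; split=> // x; rewrite inE => /predU1P[->|/vS //].
    by rewrite v0 dotzC dotz0.
  by right; exists f; split=> //; rewrite big_cons v0 scaler0 add0r.
set q := dotz (v s) (v s); have q0 : 0 < q by rewrite dotz_gt0.
pose w x := q *: v x - dotz (v x) (v s) *: v s.
have [[y [wS wT]]|[f [f0 [x xT fx] sf]]] := IHS w uST.
  pose y' := q *: y - dotz (v s) y *: v s.
  have vy x : dotz (v x) y' = dotz (w x) y.
    rewrite /w /y' -!scaleNr dotzDr dotzDl !dotzZl !dotzZr; ring.
  left; exists y'; split=> x; last by rewrite vy; apply: wT.
  rewrite inE => /predU1P[->|xS]; last by rewrite vy wS.
  rewrite /y' -!scaleNr dotzDr !dotzZr -/q; ring.
pose fs := - \sum_(x <- S ++ T) f x * dotz (v x) (v s).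
right; exists (override (fun x => q * f x) s fs).
split.
- by move=> z zT; rewrite /override neq_s // mulr_ge0 ?f0 ?ltW.
- by exists x; rewrite // /override neq_s // mulr_gt0.
- rewrite big_cons sum_override // /override eqxx -[RHS]sf /fs scaleNr scaler_suml.
  rewrite addrC -sumrB; apply: eq_bigr => z _ /=; rewrite /w scalerBr !scalerA.
  by congr (_ *: _ - _); ring.
Qed.

End Alternative.

(** Motzkin's alternative for the vectors (1, a_i): the extra coordinate makes linear forms affine
    and relations of sum 0. *)
Lemma face_or_relation (d k : nat) (a : 'I_d -> 'rV[int]_k) (S : pred 'I_d) :
  (exists (l : 'cV[int]_k) (c : int), forall i,
     if S i then (a i *m l) 0 0 = c else (a i *m l) 0 0 < c)
  \/ exists f : 'I_d -> int,
     [/\ \sum_i f i = 0, \sum_i f i *: a i = 0, forall i, ~~ S i -> 0 <= f i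
       & exists2 i, ~~ S i & 0 < f i].
Proof.
pose v i : 'rV[int]_(1 + k) := row_mx 1 (a i).
have uST : uniq ([seq i <- enum 'I_d | S i] ++ [seq i <- enum 'I_d | ~~ S i]).
  rewrite cat_uniq !(filter_uniq _ (enum_uniq _)) andbT; apply/hasPn => i.
  by rewrite !mem_filter => /andP[/negPf -> _].
have [[y [vS vT]]|[f [f0 [x xT fx] sf]]] := motzkin_alternative v uST.
  left; exists (- (rsubmx y)^T), (dotz 1 (lsubmx y)) => i.
  have vE : dotz (v i) y = dotz 1 (lsubmx y) - (a i *m - (rsubmx y)^T) 0 0.
    rewrite mulmxN !mxE opprK -[in LHS](hsubmxK y) /v /dotz tr_row_mx mul_row_col.
    by rewrite mxE; congr (_ + _); rewrite mxE.
  case: ifPn => Si.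
    have := vS i; rewrite mem_filter Si mem_enum vE => /(_ isT)/eqP.
    by rewrite subr_eq0 => /eqP ->.
  by have := vT i; rewrite mem_filter Si mem_enum vE subr_gt0 => /(_ isT).
right; exists f.
have : \sum_i f i *: v i = 0.
  rewrite -[RHS]sf -[LHS](big_enum _ _ xpredT) /=; apply: perm_big.
  by rewrite perm_sym perm_filterC.
under eq_bigr do rewrite /v scale_row_mx.
move=> sf0; split.
- have := congr1 lsubmx sf0; rewrite linear_sum /= linear0 => /matrixP/(_ 0 0).
  rewrite summxE [RHS]mxE => sf1; rewrite -[RHS]sf1; apply: eq_bigr => i _.
  by rewrite row_mxKl !mxE eqxx mulr1.
- have := congr1 rsubmx sf0; rewrite linear_sum /= linear0 => sf2; rewrite -[RHS]sf2.
  by apply: eq_bigr => i _; rewrite row_mxKr.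
- by move=> i Si; apply: f0; rewrite mem_filter Si mem_enum.
- by exists x => //; move: xT; rewrite mem_filter => /andP[].
Qed.

(** * Monomial maps of tori *)

Definition monomial (K : fieldType) k (u : 'I_k -> K) (b : 'rV[int]_k) : K :=
  \prod_(j < k) u j ^ b 0 j.

Definition mexp (K : fieldType) p q (B : 'M[int]_(p, q)) (u : 'I_q -> K) :
    'I_p -> K :=
  fun i => monomial u (row i B).

Section Monomial.
Context (K : fieldType).

Lemma prodf_expz (I : finType) (F : I -> K) (z : int) :
  \prod_i F i ^ z = (\prod_i F i) ^ z.
Proof.
by apply: (big_ind2 (fun x y => x = y ^ z)); rewrite ?exp1rz // => x1 x2 y1 y2 -> ->;
  rewrite expfzMl.
Qed.

Lemma expfz_sum (I : finType) (x : K) (F : I -> int) : x != 0 ->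
  x ^ (\sum_i F i) = \prod_i x ^ F i.
Proof.
move=> nzx; apply: (big_ind2 (fun m y => x ^ m = y)); rewrite ?expr0z //.
by move=> m1 y1 m2 y2 <- <-; rewrite expfzDr.
Qed.

Variables (k : nat) (u : 'I_k -> K).
Hypothesis nzu : forall j, u j != 0.

Lemma monomial_neq0 b : monomial u b != 0.
Proof. by apply/prodf_neq0 => j _; apply: expfz_neq0. Qed.

Lemma monomialD b b' : monomial u (b + b') = monomial u b * monomial u b'.
Proof.
by rewrite -big_split; apply: eq_bigr => j _; rewrite mxE expfzDr.
Qed.

Lemma monomial0 : monomial u 0 = 1.
Proof. by rewrite /monomial big1 // => j _; rewrite mxE expr0z. Qed.

Lemma monomialZ c b : monomial u (c *: b) = monomial u b ^ c.
Proof.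
rewrite /monomial -prodf_expz; apply: eq_bigr => j _.
by rewrite mxE mulrC exprz_exp.
Qed.

Lemma monomial_sum (I : finType) (F : I -> 'rV[int]_k) :
  monomial u (\sum_i F i) = \prod_i monomial u (F i).
Proof. exact: (big_morph _ monomialD monomial0). Qed.

Lemma monomial_mulmx p (b : 'rV[int]_p) (B : 'M[int]_(p, k)) :
  monomial u (b *m B) = monomial (mexp B u) b.
Proof.
rewrite mulmx_sum_row monomial_sum.
by apply: eq_bigr => i _; rewrite monomialZ.
Qed.

End Monomial.

Lemma exists_rootz (K : closedFieldType) (x : K) (m : int) : x != 0 -> m != 0 ->
  exists2 y : K, y != 0 & y ^ m = x.
Proof.
move=> nzx nzm.
have root n (w : K) : w != 0 -> (0 < n)%N -> exists2 y : K, y != 0 & y ^+ n = w.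
  move=> nzw n0; have /closed_rootP[y] : size ('X^n - w%:P) != 1%N.
    by rewrite size_XnsubC // eqSS -lt0n.
  rewrite rootE !hornerE subr_eq0 => /eqP yn; exists y => //.
  by apply: contraNneq nzw => y0; rewrite -yn y0 expr0n gtn_eqF.
case: m nzm => n nzn; first by apply: root; rewrite // lt0n.
have [y nzy yn] := root n.+1 x^-1 (invr_neq0 nzx) isT.
by exists y => //; rewrite NegzE -exprnN yn invrK.
Qed.

(* C^* is divisible, so characters of a sublattice extend: by the Smith normal
   form one is reduced to solving w_j ^ d_j = z_j. *)
Lemma exists_mexp (K : closedFieldType) p q (B : 'M[int]_(p, q)) (z : 'I_p -> K) :
    (forall i, z i != 0) ->
    (forall f : 'rV[int]_p, f *m B = 0 -> monomial z f = 1) ->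
  exists2 u : 'I_q -> K, forall j, u j != 0 & forall i, z i = monomial u (row i B).
Proof.
move=> nzz z1; have [L uL [R uR [e _ BE]]] := int_Smith_normal_form B.
set D := \matrix_(i, j) _ in BE.
(* In the coordinates given by [L] and [R] the system is diagonal. *)
pose z' := mexp (invmx L) z.
have nzz' i : z' i != 0 by apply: monomial_neq0.
have [w nzw wE] : exists2 w : 'I_q -> K, forall j, w j != 0 &
    forall (j : 'I_q) (i : 'I_p), i = j :> nat -> e`_i != 0 -> w j ^ e`_i = z' i.
  have h j : exists wj : K, wj != 0 /\
      forall i : 'I_p, i = j :> nat -> e`_i != 0 -> wj ^ e`_i = z' i.
    have [/existsP[i /andP[/eqP ij nze]]|none] :=
      boolP [exists i : 'I_p, (i == j :> nat) && (e`_i != 0)].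
      have [y nzy yE] := exists_rootz (nzz' i) nze; exists y; split=> // i' i'j _.
      by have -> : i' = i by apply: val_inj; rewrite /= i'j.
    (* A coordinate meeting no nonzero diagonal entry is free. *)
    exists 1; split=> [|i ij nze]; first exact: oner_neq0.
    by case/existsP: none; exists i; rewrite ij eqxx -ij.
  exists (fun j => sval (cid (h j))) => [j|j i]; case: cid => wj /= [] //.
  by move=> _; apply.
have nzu j : mexp (invmx R) w j != 0 by apply: monomial_neq0.
have nzRu : forall j, mexp R (mexp (invmx R) w) j = w j.
  move=> j; rewrite /mexp -monomial_mulmx // -row_mul mulmxV // row1.
  rewrite /monomial (bigD1 j) //= big1 ?mulr1 => [|l lj].
    by rewrite mxE !eqxx expr1z.
  by rewrite mxE (negPf lj) expr0z.
have DE i : monomial w (row i D) = z' i.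
  have [/existsP[j /andP[/eqP ij nze]]|none] :=
    boolP [exists j : 'I_q, (i == j :> nat) && (e`_i != 0)].
    rewrite /monomial (bigD1 j) //= big1 ?mulr1 => [|l lj].
      by rewrite !mxE ij eqxx mulr1n -ij wE.
    by rewrite !mxE ij eq_sym val_eqE (negPf lj) mulr0n expr0z.
  (* Row [i] of [invmx L] then lies in the left kernel of [B], where the hypothesis gives value
     1. *)
  have rD : row i D = 0.
    apply/rowP => j; rewrite !mxE; case: eqP => [ij|//]; rewrite mulr1n.
    apply/eqP/negPn/negP => nze; case/existsP: none; exists j.
    by rewrite ij eqxx -ij.
  rewrite rD monomial0 /z' /mexp z1 // -row_mul BE !mulmxA mulVmx // mul1mx.
  by rewrite row_mul rD mul0mx.
exists (mexp (invmx R) w) => // i.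
rewrite BE -mulmxA row_mul monomial_mulmx //.
have -> : mexp (D *m R) (mexp (invmx R) w) = z'.
  apply: funext => i'; rewrite /mexp row_mul monomial_mulmx //.
  rewrite -DE; congr monomial; apply: funext => j; exact: nzRu.
rewrite /z' -monomial_mulmx // -row_mul mulmxV // row1.
rewrite /monomial (bigD1 i) //= big1 ?mulr1 => [|l li].
  by rewrite mxE !eqxx expr1z.
by rewrite mxE (negPf li) expr0z.
Qed.

(** * Toric cones *)

(** The positive part, used to write a relation as a binomial that makes sense at zero
    coordinates. *)
Definition posn (m : int) : nat := if m is Posz n then n else 0%N.

Lemma posnB m : (posn m)%:Z - (posn (- m))%:Z = m.
Proof. by case: m => [[|n]|n]; rewrite /= ?subr0 ?sub0r. Qed.

(* The affine cone over the toric variety of [a], cut out by all its binomial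
   equations. *)
Definition toric_cone (K : fieldType) (d k : nat) (a : 'I_d -> 'rV[int]_k)
    (z : 'I_d -> K) : Prop :=
  forall f : 'I_d -> int, \sum_i f i = 0 -> \sum_i f i *: a i = 0 ->
    \prod_i z i ^+ posn (f i) = \prod_i z i ^+ posn (- f i).

Section ToricCone.
Context (K : closedFieldType) (d k : nat) (a : 'I_d -> 'rV[int]_k).
Implicit Types (z : 'I_d -> K) (u : 'I_k -> K).

Lemma prod_posn (x : 'I_d -> K) f : (forall i, x i != 0) ->
  \prod_i x i ^+ posn (f i) = \prod_i x i ^ f i * \prod_i x i ^+ posn (- f i).
Proof.
move=> nzx; rewrite -big_split; apply: eq_bigr => i _ /=.
have -> : x i ^ f i = x i ^+ posn (f i) / x i ^+ posn (- f i).
  by rewrite -[in LHS](posnB (f i)) expfzDr // -exprnN -exprnP.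
by rewrite divfK // expf_neq0.
Qed.

(** The binomials are homogeneous, since the positive and negative parts of [f] have equal sums. *)
Lemma toric_coneZ z c : toric_cone a z -> toric_cone a (fun i => c * z i).
Proof.
move=> tz f f0 fa.
have cE g : \prod_i (c * z i) ^+ g i = c ^+ (\sum_i g i) * \prod_i z i ^+ g i.
  rewrite -prodrXr -big_split /=.
  by apply: eq_bigr => i _; rewrite exprMn.
rewrite !cE tz //; congr (c ^+ _ * _).
apply/eqP; rewrite -eqz_nat; apply/eqP.
rewrite !(big_morph Posz PoszD (erefl 0)); apply/eqP.
by rewrite -subr_eq0 -sumrB; under eq_bigr do rewrite posnB; rewrite f0.
Qed.

(** The binomials force the support of [z] to be a face; on it they make [z] a character of the
    lattice of exponents, which extends to the whole torus. *)
Lemma toric_cone_structure z i0 : toric_cone a z -> z i0 != 0 ->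
  exists (l : 'cV[int]_k) (c : int) (s : K) (u : 'I_k -> K),
  [/\ s != 0, forall j, u j != 0
    & forall i, if z i != 0 then (a i *m l) 0 0 = c /\ z i = s * monomial u (a i)
                else (a i *m l) 0 0 < c].
Proof.
move=> tz nz0.
have [[l [c lc]]|[f [f0 fa fpos [x zx fx]]]] :=
    face_or_relation a (fun i => z i != 0); last first.
  (* The zero coordinate [z x] kills the left side, while on the right only indices with negative
     [f i] matter, and there [z i] is nonzero. *)
  have := tz f f0 fa; rewrite (bigD1 x) //= (eqP (negbNE zx)) expr0n.
  case: (f x) fx => // -[//|n] _ /=; rewrite mul0r => /esym/eqP.
  rewrite prodf_seq_eq0 => /hasP[i _ /=]; rewrite expf_eq0 => /andP[ni zi].
  by have := fpos i; rewrite zi => /(_ isT); case: (f i) ni => // -[].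
pose S i := z i != 0.
pose z1 i := if S i then z i else 1.
(* Off the support, zero rows and the value 1 impose nothing; the column of ones produces the factor
   [s]. *)
pose B : 'M[int]_(d, 1 + k) :=
  \matrix_i (if S i then row_mx 1 (a i) else 0 : 'rV_(1 + k)).
have nz1 i : z1 i != 0 by rewrite /z1; case: ifP => //; rewrite oner_eq0.
case: (@exists_mexp _ _ _ B z1) => // [f fB|u nzu uE].
  pose g i := if S i then f 0 i else 0.
  have gB : \sum_i g i *: (row_mx 1 (a i) : 'rV_(1 + k)) = 0.
    rewrite -[RHS]fB mulmx_sum_row; apply: eq_bigr => i _.
    by rewrite rowK /g; case: ifP => _; rewrite ?scale0r ?scaler0.
  have g0 : \sum_i g i = 0.
    have := congr1 lsubmx gB; rewrite linear_sum /= linear0 => /matrixP/(_ 0 0).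
    rewrite summxE [RHS]mxE => h; rewrite -[RHS]h; apply: eq_bigr => i _.
    by rewrite scale_row_mx row_mxKl !mxE eqxx mulr1.
  have ga : \sum_i g i *: a i = 0.
    have := congr1 rsubmx gB; rewrite linear_sum /= linear0 => h; rewrite -[RHS]h.
    by apply: eq_bigr => i _; rewrite scale_row_mx row_mxKr.
  have := tz g g0 ga.
  have zg h : (forall i, ~~ S i -> h i = 0%N) ->
      \prod_i z i ^+ h i = \prod_i z1 i ^+ h i.
    move=> h0; apply: eq_bigr => i _; rewrite /z1.
    by case: ifPn => // /h0 ->.
  rewrite !zg; try by move=> i /negPf Si; rewrite /g Si.
  have nzP : \prod_i z1 i ^+ posn (- g i) != 0.
    by apply/prodf_neq0 => i _; apply: expf_neq0.
  rewrite prod_posn // -[RHS]mul1r => /(mulIf nzP) h; rewrite -[RHS]h.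
  rewrite /monomial; apply: eq_bigr => i _.
  by rewrite /z1 /g; case: ifP; rewrite ?exp1rz.
exists l, c, (u (lshift k 0)), (fun j => u (rshift 1 j)); split=> // i.
have := lc i; case: ifP => // nzi lcE; split=> //.
have := uE i; rewrite /z1 /S nzi rowK /S nzi => ->.
rewrite /monomial big_split_ord /= big_ord1; congr (_ * _).
  by rewrite row_mxEl mxE eqxx expr1z.
by apply: eq_bigr => j _; rewrite row_mxEr.
Qed.

(** With [h] the height of the points above a face, both sides of a binomial have the same weight:
    if it is positive both vanish, otherwise only points of the face occur. *)
Lemma toric_cone_face (F : realFieldType) (h : 'I_d -> F) (s : K) u :
    s != 0 -> (forall j, u j != 0) -> (forall i, 0 <= h i) ->
    (forall f : 'I_d -> int, \sum_i f i = 0 -> \sum_i f i *: a i = 0 ->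
      \sum_i (f i)%:~R * h i = 0) ->
  toric_cone a (fun i => if h i == 0 then s * monomial u (a i) else 0).
Proof.
move=> nzs nzu h_ge0 h_lin f f0 fa.
pose x i := s * monomial u (a i).
have nzx i : x i != 0 by rewrite mulf_neq0 // monomial_neq0.
have x1 : \prod_i x i ^ f i = 1.
  rewrite /x; under eq_bigr do rewrite expfzMl.
  rewrite big_split /= -expfz_sum // f0 expr0z mul1r.
  under eq_bigr do rewrite -monomialZ.
  by rewrite -monomial_sum // fa monomial0.
pose w (g : 'I_d -> int) := \sum_i (posn (g i))%:R * h i.
have w_ge0 g i : 0 <= (posn (g i))%:R * h i by rewrite mulr_ge0 ?ler0n.
have prodE g : \prod_i (if h i == 0 then x i else 0) ^+ posn (g i) =
    if w g == 0 then \prod_i x i ^+ posn (g i) else 0.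
  case: eqP => [/psumr_eq0P w0|].
    apply: eq_bigr => i _; case: eqP => // /eqP nzh.
    have /eqP := w0 (fun i _ => w_ge0 g i) i isT.
    by rewrite mulf_eq0 (negPf nzh) orbF pnatr_eq0 => /eqP ->.
  move/eqP; rewrite psumr_neq0 => // /hasP[i _ /=].
  rewrite lt0r mulf_eq0 negb_or => /andP[/andP[nzp nzh] _].
  by rewrite (bigD1 i) //= (negPf nzh) expr0n -(eqr_nat F) (negPf nzp) mul0r.
rewrite [LHS](prodE f) [RHS](prodE (fun i => - f i)).
have -> : w (fun i => - f i) = w f.
  apply/eqP; rewrite eq_sym -subr_eq0 -sumrB -[X in _ == X](h_lin f f0 fa); apply/eqP.
  apply: eq_bigr => i _; rewrite -mulrBl; congr (_ * _).
  by rewrite -[f i in RHS]posnB rmorphB.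
by case: ifP => // _; rewrite prod_posn // x1 mul1r.
Qed.

Definition torus_solvable r (t : 'I_r -> 'I_d -> K) : Prop :=
  exists2 u : 'I_k -> K, forall j, u j != 0 &
    forall i, \sum_j t i j * monomial u (a j) = 0.

(** A common zero on the projective toric variety, boundary orbits included. *)
Definition toric_solvable r (t : 'I_r -> 'I_d -> K) : Prop :=
  exists z, [/\ toric_cone a z, exists i, z i != 0 &
    forall i, \sum_j t i j * z j = 0].

Lemma monomial_toric_cone u : (forall j, u j != 0) ->
  toric_cone a (fun i => monomial u (a i)).
Proof.
move=> nzu f f0 fa; rewrite prod_posn; last by move=> i; apply: monomial_neq0.
under eq_bigr do rewrite -monomialZ.
by rewrite -monomial_sum // fa monomial0 mul1r.
Qed.

(* Move the point z of the orbit of a face along a one-parameter subgroup into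
   the big torus, and correct the coefficients at one point of the face so that
   the equations remain satisfied. *)
Lemma toric_solvable_deformation r (t : 'I_r -> 'I_d -> K) : toric_solvable t ->
  exists p : 'I_r -> 'I_d -> {poly K},
    (forall i j, (p i j).[0] = t i j) /\
    (forall c, c != 0 -> torus_solvable (fun i j => (p i j).[c])).
Proof.
case=> z [tz [j0 nz0] zt].
have [l [c [s [u [nzs nzu zE]]]]] := toric_cone_structure tz nz0.
(* The height over the face supporting [z], hence the order of vanishing of the j-th coordinate
   along the curve [Y]. *)
pose e j := `|(c - (a j *m l) 0 0)%R|%N.
have eE j : (e j)%:Z = c - (a j *m l) 0 0.
  rewrite /e gez0_abs // subr_ge0.
  by have := zE j; case: ifP => [_ [-> _]|_ /ltW].
pose Y j := (monomial u (a j))%:P * 'X^(e j).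
have Y0 j : (Y j).[0] = s^-1 * z j.
  rewrite /Y !hornerE expr0n -eqz_nat eE subr_eq0 eq_sym.
  have := zE j; case: ifPn => [_ [-> ->]|/negbNE/eqP -> /lt_eqF ->].
    by rewrite eqxx mulr1 mulKf.
  by rewrite !mulr0.
have Yj0 x : (Y j0).[x] = monomial u (a j0).
  have e0 : e j0 = 0%N.
    apply/eqP; rewrite -eqz_nat eE; have := zE j0.
    by rewrite nz0 => -[-> _]; rewrite subrr.
  by rewrite /Y e0 !hornerE.
(* The defect of equation [i] along the curve is absorbed at [j0], where [Y j0] is a nonzero
   constant. *)
pose G i := \sum_j (t i j)%:P * Y j.
pose p i j := (t i j)%:P - (if j == j0 then (monomial u (a j0))^-1%:P * G i else 0).
exists p; split=> [i j|x nzx].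
  rewrite /p hornerD hornerN hornerC; case: eqP => _; last by rewrite horner0 subr0.
  rewrite hornerM [(G i).[0]]horner_sum.
  under eq_bigr do rewrite hornerM hornerC Y0 mulrCA.
  by rewrite -mulr_sumr zt !mulr0 subr0.
exists (fun m => u m * x ^ (- l m 0)) => [m|i].
  by rewrite mulf_neq0 ?expfz_neq0.
have mE j : monomial (fun m => u m * x ^ (- l m 0)) (a j) = x ^ (- c) * (Y j).[x].
  rewrite /Y hornerM hornerXn hornerC exprnP eE mulrCA -expfzDr // addKr.
  rewrite /monomial; under eq_bigr do rewrite expfzMl.
  rewrite big_split /=; congr (_ * _); rewrite mxE -sumrN expfz_sum //.
  by apply: eq_bigr => m _; rewrite exprz_exp mulNr mulrC.
under eq_bigr do rewrite mE mulrCA.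
rewrite -mulr_sumr; apply/eqP; rewrite mulf_eq0; apply/orP; right; apply/eqP.
under eq_bigr do rewrite /p hornerD hornerN mulrBl hornerC.
rewrite sumrB [X in _ - X](bigD1 j0) //= eqxx [\sum_(_ < _ | _ != _) _]big1 ?addr0;
  last first.
  by move=> j /negPf ->; rewrite horner0 mul0r.
rewrite hornerM hornerC Yj0 mulrAC mulVf ?monomial_neq0 // mul1r.
rewrite horner_sum; apply/eqP; rewrite subr_eq0; apply/eqP.
by apply: eq_bigr => j _; rewrite [RHS]hornerM hornerC.
Qed.

End ToricCone.

(** * Closedness of toric solvability *)

Section ToricSolvable.
Context (K : closedFieldType) (d k : nat) (a : 'I_d -> 'rV[int]_k).

Lemma toric_solvable_closed N r (l : 'I_r -> 'I_d -> {mpoly K[N]})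
    (t0 : 'I_N -> K) :
    ~ toric_solvable a (fun i j => (l i j).@[t0]) ->
  exists2 p : {mpoly K[N]}, p.@[t0] != 0 &
    forall t, toric_solvable a (fun i j => (l i j).@[t]) -> p.@[t] = 0.
Proof.
move=> not_solvable.
pose phi (t : 'I_N -> K) : {rmorphism {mpoly K[N]} -> K} := meval t.
pose iota : {rmorphism K -> {mpoly K[N]}} := @mpolyC N K.
have phi_iota t c : phi t (iota c) = c by apply: mevalC.
pose Z (t : 'I_N -> K) (y : nat -> K) :=
  toric_cone a (fun i => y i) /\ forall i, \sum_j (l i j).@[t] * y j = 0.
have coneZ t y c : Z t y -> c != 0 -> Z t (fun i => c * y i).
  move=> [ty ly] _; split=> [|i]; first exact: toric_coneZ.
  by under eq_bigr do rewrite mulrCA; rewrite -mulr_sumr ly mulr0.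
have [y i lt_id nzy cl_y|p nzp p0] :=
    @projective_elimination _ _ iota _ phi phi_iota Z coneZ t0 d.
  (* The equations defining [Z] vanish on [Z], hence at every point of its closure. *)
  apply: not_solvable; exists (fun i => y i); split; last 1 first.
  - move=> i'.
    pose F := \sum_j tconst _ d (l i' j) * tvar {mpoly K[N]} d j.
    have FE t y' : teval phi t y' d F = \sum_j (l i' j).@[t] * y' j.
      rewrite rmorph_sum; apply: eq_bigr => j _.
      by rewrite rmorphM teval_const teval_var.
    by rewrite -FE; apply: cl_y => t y' [_ ly]; rewrite FE.
  - move=> f f0 fa; apply/eqP; rewrite -subr_eq0; apply/eqP.
    pose F := \prod_(j < d) tvar {mpoly K[N]} d j ^+ posn (f j) -
              \prod_(j < d) tvar {mpoly K[N]} d j ^+ posn (- f j).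
    have FE t y' : teval phi t y' d F =
        \prod_(j < d) y' j ^+ posn (f j) - \prod_(j < d) y' j ^+ posn (- f j).
      rewrite rmorphB !rmorph_prod; congr (_ - _); apply: eq_bigr => j _;
        by rewrite rmorphXn teval_var.
    by rewrite -(FE t0 y); apply: cl_y => t y' [ty _]; rewrite FE ty // subrr.
  - by exists (Ordinal lt_id).
exists p => // t [z [tz [i nzi] zl]].
pose y n := if insub n is Some j then z j else 0.
have yE (j : 'I_d) : y j = z j by rewrite /y valK.
apply: (p0 t y i); rewrite ?yE //; split=> [|i'].
  by rewrite (funext yE).
by under eq_bigr do rewrite yE.
Qed.

End ToricSolvable.

Lemma horner_mmap (K : comNzRingType) N (p : {mpoly K[N]})
    (q : 'I_N -> {poly K}) c :
  (mmap polyC q p).[c] = p.@[fun i => (q i).[c]].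
Proof.
rewrite mevalE /mmap horner_sum; apply: eq_bigr => m _.
rewrite hornerM hornerC; congr (_ * _); rewrite /mmap1 horner_prod.
by apply: eq_bigr => i _; rewrite horner_exp.
Qed.

(** Injectivity over Z leaves no zero row in the Smith form, and its nonzero integers stay nonzero
    in characteristic 0. *)
Lemma mulmx_intr_inj (F : numFieldType) m k (M : 'M[int]_(m, k)) :
    (forall y : 'rV[int]_m, y *m M = 0 -> y = 0) ->
  forall v : 'rV[F]_m, v *m map_mx intr M = 0 -> v = 0.
Proof.
move=> injM v; have [L uL [Q uQ [e _ ME]]] := int_Smith_normal_form M.
set D := \matrix_(i, j) _ in ME.
have nzD i : row i D != 0.
  apply/eqP => rD; have /rowP/(_ i) : row i (invmx L *m L) = 0.
    rewrite row_mul (injM (row i (invmx L))) ?mul0mx // ME !mulmxA -!row_mul.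
    by rewrite mulVmx // mul1mx row_mul rD mul0mx.
  by rewrite mulVmx // !mxE eqxx => /eqP; rewrite oner_eq0.
have unitF n (U : 'M[int]_n) : U \in unitmx -> map_mx intr U \in @unitmx F n.
  by rewrite !unitmxE det_map_mx => /(rmorph_unit (intr : {rmorphism int -> F})).
rewrite ME !map_mxM !mulmxA => /(congr1 (mulmx^~ (invmx (map_mx intr Q)))).
rewrite mulmxK ?unitF // mul0mx => vLD.
suff vL0 : v *m map_mx intr L = 0.
  by rewrite -[v](@mulmxK _ _ _ (map_mx intr L)) ?unitF // vL0 mul0mx.
apply/rowP => i; rewrite [RHS]mxE.
have /rV0Pn[j] := nzD i; rewrite !mxE => nze.
have ij : i = j :> nat by apply/eqP; apply: contraNT nze => /negPf ->.
move/rowP/(_ j): vLD; rewrite [LHS]mxE [RHS]mxE (bigD1 i) //= big1 ?addr0.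
  rewrite [map_mx _ _ _ _]mxE [D _ _]mxE => /eqP.
  rewrite mulf_eq0 intr_eq0 (negPf nze) orbF.
  by move/eqP => vL; rewrite -[RHS]vL mxE.
move=> i' ni; rewrite [map_mx _ _ _ _]mxE [D _ _]mxE -ij.
by rewrite val_eqE (negPf ni) mulr0n mulr0.
Qed.

Definition logcoef (K : fieldType) d m (b : 'I_d -> 'rV[int]_m)
    (alpha : 'I_d -> K) (i : 'I_m.+1) (j : 'I_d) : K :=
  (if unlift ord_max i is Some l then (b j 0 l)%:~R else 1) * alpha j.

Lemma logcoefP (K : fieldType) d m (b : 'I_d -> 'rV[int]_m) (alpha z : 'I_d -> K) :
  (forall i, \sum_j logcoef b alpha i j * z j = 0) <->
  \sum_j alpha j * z j = 0 /\
  forall l, \sum_j alpha j * z j * (b j 0 l)%:~R = 0.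
Proof.
split=> [sum0|[s0 sl] i].
  split=> [|l].
    rewrite -[RHS](sum0 ord_max); apply: eq_bigr => j _.
    by rewrite /logcoef unlift_none mul1r.
  rewrite -[RHS](sum0 (fintype.lift ord_max l)); apply: eq_bigr => j _.
  by rewrite /logcoef liftK mulrC mulrA.
rewrite /logcoef; case: unliftP => [l _|_]; last by under eq_bigr do rewrite mul1r.
by rewrite -[RHS](sl l); apply: eq_bigr => j _; rewrite [RHS]mulrC mulrA.
Qed.

(** The affine relations of [a] and [b] agree because [M] is injective. In the equations the
    translation [c] drops out, as the weights alpha_j z_j sum to 0. *)
Lemma toric_solvable_lattice (K : numClosedFieldType) d k m
    (a : 'I_d -> 'rV[int]_k) (b : 'I_d -> 'rV[int]_m) (alpha : 'I_d -> K) :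
  lattice_coordinates a b ->
  toric_solvable a (logcoef a alpha) <-> toric_solvable b (logcoef b alpha).
Proof.
case=> M [c [inj_phi _ phi_b]].
have injM (y : 'rV[int]_m) : y *m M = 0 -> y = 0.
  by move=> yM; apply: inj_phi; rewrite yM mul0mx.
have coneE z : toric_cone a z <-> toric_cone b z.
  have sumE f : \sum_i f i = 0 -> \sum_i f i *: a i = (\sum_i f i *: b i) *m M.
    move=> f0; under eq_bigr do rewrite -phi_b scalerDr.
    rewrite big_split /= -scaler_suml f0 scale0r addr0 mulmx_suml.
    by apply: eq_bigr => i _; rewrite scalemxAl.
  split=> tz f f0 fa; apply: tz => //; first by rewrite sumE // fa mul0mx.
  by apply: injM; rewrite -sumE.
have sumE (w : 'I_d -> K) : \sum_j w j = 0 ->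
    (forall l, \sum_j w j * (a j 0 l)%:~R = 0) <->
    (forall l, \sum_j w j * (b j 0 l)%:~R = 0).
  move=> w0; pose v : 'rV[K]_m := \row_l \sum_j w j * (b j 0 l)%:~R.
  have vM l : \sum_j w j * (a j 0 l)%:~R = (v *m map_mx intr M) 0 l.
    rewrite mxE; under [RHS]eq_bigr do rewrite !mxE mulr_suml.
    rewrite exchange_big /=.
    under eq_bigr do rewrite -phi_b !mxE rmorphD mulrDr.
    rewrite big_split /= -mulr_suml w0 mul0r addr0; apply: eq_bigr => j _.
    rewrite rmorph_sum mulr_sumr; apply: eq_bigr => i _.
    by rewrite rmorphM mulrA.
  split=> [wa l|wb l].
    have /rowP/(_ l) : v = 0.
      by apply: mulmx_intr_inj injM _ _; apply/rowP => j; rewrite -vM wa mxE.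
    by rewrite !mxE.
  rewrite vM; suff -> : v = 0 by rewrite mul0mx mxE.
  by apply/rowP => j; rewrite !mxE wb.
by split=> -[z [tz nz /logcoefP[z0 zl]]]; exists z; split=> //;
  by [apply/coneE | apply/logcoefP; split=> //; apply/(sumE _ z0)].
Qed.

(** * Discriminants and resultants *)

Lemma fglift_sum (K : choiceType) (S : nzRingType) (M : lmodType S) (f : K -> M)
    (I : finType) (c : I -> S) (x : I -> K) :
  fglift f (\sum_i << c i *g x i >>) = \sum_i c i *: f (x i).
Proof.
pose lf : {additive {freeg K / S} -> M} :=
  HB.pack (fglift f) (GRing.isZmodMorphism.Build _ _ _ (lift_is_additive f)).
transitivity (\sum_i lf << c i *g x i >>); first exact: (raddf_sum lf).
by apply: eq_bigr => i _; apply: liftU.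
Qed.

Lemma big_sig (S : nmodType) (I : finType) (P : pred I) (F : I -> S) :
  \sum_(x : {i | P i}) F (val x) = \sum_(i | P i) F i.
Proof.
rewrite (reindex_omap (val : {i | P i} -> I) insub); last first.
  by move=> i Pi; rewrite insubT.
by apply: eq_bigl => x; rewrite (valP x) valK eqxx.
Qed.

Section LaurentEvaluation.
Context (R : realType) (k : nat) (I : finType) (b : I -> 'rV[int]_k).
Context (alpha : I -> R[i]).
Local Notation C := R[i].

Lemma leval_sum (u : 'I_k -> C) (c : I -> C) (x : I -> 'rV[int]_k) :
  leval (\sum_i << c i *g x i >>) u = \sum_i c i * monomial u (x i).
Proof. exact: fglift_sum. Qed.

Lemma lderiv_laurent_of (j : 'I_k) : lderiv j (laurent_of b alpha) =
  \sum_i << alpha i * (b i 0 j)%:~R *g b i - delta_mx 0 j >>.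
Proof.
rewrite /lderiv fglift_sum; apply: eq_bigr => i _.
by apply/eqP/freeg_eqP => x; rewrite coeffZ !coeffU mulrA.
Qed.

Lemma leval_laurent_of (u : 'I_k -> C) :
  leval (laurent_of b alpha) u = \sum_i alpha i * monomial u (b i).
Proof. exact: leval_sum. Qed.

(** The factor x_j^(-1) is nonzero on the torus, so ordinary and logarithmic derivatives vanish
    together. *)
Lemma leval_lderiv (u : 'I_k -> C) (j : 'I_k) : torus u ->
  leval (lderiv j (laurent_of b alpha)) u =
  monomial u (- delta_mx 0 j) *
    \sum_i alpha i * monomial u (b i) * (b i 0 j)%:~R.
Proof.
move=> nzu; rewrite lderiv_laurent_of leval_sum mulr_sumr.
by apply: eq_bigr => i _; rewrite monomialD //; ring.
Qed.

Lemma lmulX_lderiv (j : 'I_k) : lmulX j (lderiv j (laurent_of b alpha)) =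
  \sum_i << alpha i * (b i 0 j)%:~R *g b i >>.
Proof.
rewrite lderiv_laurent_of /lmulX fglift_sum; apply: eq_bigr => i _.
by apply/eqP/freeg_eqP => x; rewrite coeffZ !coeffU subrK mul1r.
Qed.

End LaurentEvaluation.

Lemma coeff_log_derivatives (R : realType) m d (b : 'I_d -> 'rV[int]_m)
    (alpha : 'I_d -> R[i]) (i : 'I_m.+1) (j : 'I_d) : injective b ->
  coeff (b j) (log_derivatives (laurent_of b alpha) i) = logcoef b alpha i j.
Proof.
move=> b_inj.
have coeff_sum (c : 'I_d -> R[i]) : coeff (b j) (\sum_l << c l *g b l >>) = c j.
  rewrite raddf_sum (bigD1 j) //= coeffU eqxx mulr1 big1 ?addr0 // => l lj.
  by rewrite coeffU (inj_eq b_inj) (negPf lj) mulr0.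
rewrite /log_derivatives /logcoef; case: unliftP => [l _|_].
  by rewrite lmulX_lderiv coeff_sum mulrC.
by rewrite coeff_sum mul1r.
Qed.

Section DiscriminantUnion.
Context (R : realType) (k d : nat) (a : 'I_d -> 'rV[int]_k).
Local Notation C := R[i].
Local Notation P := (@newton_polytope R k d a).

Lemma real_point_newton i : P (real_point R (a i)).
Proof.
exists (fun j => (j == i)%:R); split=> [j||].
- exact: ler0n.
- by rewrite (bigD1 i) //= eqxx big1 ?addr0 // => j /negPf ->.
- rewrite (bigD1 i) //= eqxx scale1r big1 ?addr0 // => j /negPf ->.
  by rewrite scale0r.
Qed.

Lemma combination_mulmx (w : 'I_d -> R) (l : 'cV[R]_k) :
  ((\sum_i w i *: real_point R (a i)) *m l) 0 0 =
  \sum_i w i * (real_point R (a i) *m l) 0 0.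
Proof.
rewrite mulmx_suml summxE; apply: eq_bigr => i _.
by rewrite -scalemxAl mxE.
Qed.

Lemma discriminant_unionE :
  discriminant_union R a = [set alpha | toric_solvable a (logcoef a alpha)].
Proof.
apply/seteqP; split=> alpha /=.
  case=> F [[l [c [lc FE]]] [x0 Fx0]] [u nzu [/= f0 df0]].
  (* The distance to the supporting hyperplane, zero exactly at the points of A on [F]. *)
  pose h i := c - (real_point R (a i) *m l) 0 0.
  have h_ge0 i : 0 <= h i by rewrite subr_ge0; apply/lc/real_point_newton.
  have FhE i : `[< F (real_point R (a i)) >] = (h i == 0).
    rewrite /h subr_eq0 FE; apply/asboolP/eqP => [[_ ->//]|hi].
    by split; [apply: real_point_newton | rewrite /= hi].
  pose z i := if h i == 0 then 1 * monomial u (a i) else 0.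
  exists z; split.
  - apply: toric_cone_face => //; first exact: oner_neq0.
    move=> f sf sfa; rewrite /h; under eq_bigr do rewrite mulrBr.
    rewrite sumrB -mulr_suml -rmorph_sum sf mul0r sub0r -combination_mulmx.
    suff -> : \sum_i (f i)%:~R *: real_point R (a i) = 0.
      by rewrite mul0mx mxE oppr0.
    transitivity (real_point R (\sum_i f i *: a i)).
      by rewrite /real_point map_mx_sum; apply: eq_bigr => i _; rewrite map_mxZ.
    by rewrite sfa /real_point map_mx0.
  (* A nonempty face contains a point of A: a convex combination of positive heights cannot be 0. *)
  - apply: contrapT => z0.
    have h_gt0 i : 0 < h i.
      rewrite lt0r h_ge0 andbT; apply: contra_notN z0 => hi; exists i.
      by rewrite /z hi mul1r monomial_neq0.
    move: Fx0; rewrite FE => -[[w [w0 w1 ->]]] /=.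
    rewrite combination_mulmx => wc.
    have /psumr_eq0P wh0 : \sum_i w i * h i = 0.
      under eq_bigr do rewrite mulrBr.
      by rewrite sumrB -mulr_suml w1 mul1r wc subrr.
    have w_eq0 i : w i = 0.
      have /eqP := wh0 (fun i _ => mulr_ge0 (w0 i) (h_ge0 i)) i isT.
      by rewrite mulf_eq0 (gt_eqF (h_gt0 i)) orbF => /eqP.
    by move: w1; rewrite big1 // => /esym/eqP; rewrite oner_eq0.
  have sumE (g : 'I_d -> C) : \sum_i alpha i * z i * g i =
      \sum_(i : face_index a F) alpha (val i) * monomial u (a (val i)) * g (val i).
    rewrite (big_sig _ (fun i => alpha i * monomial u (a i) * g i)).
    rewrite [RHS]big_mkcond; apply: eq_bigr => i _.
    by rewrite FhE /z mul1r; case: ifP; rewrite ?mulr0 ?mul0r.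
  apply/logcoefP; split=> [|j].
    have := sumE (fun=> 1); under eq_bigr do rewrite mulr1.
    move=> ->; rewrite -[RHS]f0 leval_laurent_of.
    by apply: eq_bigr => i _; rewrite mulr1.
  have := df0 j; rewrite leval_lderiv // => /eqP.
  rewrite mulf_eq0 (negPf (monomial_neq0 nzu _)) /= => /eqP df; rewrite -[RHS]df.
  exact: (sumE (fun i => (a i 0 j)%:~R)).
case=> z [tz [i0 nz0] /logcoefP[z0 za]].
have [l [c [s [u [nzs nzu zE]]]]] := toric_cone_structure tz nz0.
pose lR : 'cV[R]_k := map_mx intr l.
have lRE i : (real_point R (a i) *m lR) 0 0 = ((a i *m l) 0 0)%:~R.
  by rewrite /real_point -map_mxM mxE.
have lE i : (z i != 0) = ((a i *m l) 0 0 == c).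
  by have := zE i; case: ifP => [_ [-> _]|_ /lt_eqF ->]; rewrite ?eqxx.
(* The integral functional [l] exposes the face whose points of A are the support of [z]. *)
pose F := P `&` [set x | (x *m lR) 0 0 = c%:~R].
have FE i : `[< F (real_point R (a i)) >] = (z i != 0).
  rewrite lE; apply/asboolP/eqP => [[_ /=]|ac].
    by rewrite lRE => /eqP; rewrite eqr_int => /eqP.
  by split; [apply: real_point_newton | rewrite /= lRE ac].
exists F.
  split; last by exists (real_point R (a i0)); apply/asboolP; rewrite FE.
  exists lR, c%:~R; split=> // _ [w [w0 w1 ->]].
  rewrite combination_mulmx -[leRHS]mul1r -[X in _ <= X * _]w1 mulr_suml.
  apply: ler_sum => i _; apply: ler_wpM2l; first exact: w0.
  rewrite lRE ler_int.
  by have := zE i; case: ifP => [_ [-> _]|_ /ltW].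
have sumE (g : 'I_d -> C) :
    \sum_(i : face_index a F) alpha (val i) * monomial u (a (val i)) * g (val i) =
    s^-1 * \sum_i alpha i * z i * g i.
  rewrite (big_sig _ (fun i => alpha i * monomial u (a i) * g i)).
  rewrite big_mkcond mulr_sumr; apply: eq_bigr => i _; rewrite FE.
  have := zE i; case: ifPn => [_ [_ ->]|/negbNE/eqP -> _].
    by field.
  by rewrite !(mulr0, mul0r).
exists u => //=; split=> [|j].
  rewrite leval_laurent_of; have := sumE (fun=> 1).
  rewrite [X in _ * X](_ : _ = 0) ?mulr0; last first.
    by rewrite -[RHS]z0; apply: eq_bigr => i _; rewrite mulr1.
  by move=> h; rewrite -[RHS]h; apply: eq_bigr => i _; rewrite mulr1.
rewrite leval_lderiv // (sumE (fun i => (a i 0 j)%:~R)).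
by rewrite za !mulr0.
Qed.

End DiscriminantUnion.

(** * Zero locus of the resultant *)

Section Resultant.
Context (R : realType) (m d : nat) (b : 'I_d -> 'rV[int]_m).
Local Notation C := R[i].

Lemma tuple_pointE (t : 'I_m.+1 -> 'I_d -> C) i j :
  tuple_point t (mxvec_index i j) = t i j.
Proof. by rewrite /tuple_point mxvecE mxE. Qed.

Lemma closure_common_zero_tuples : (0 < d)%N ->
  zariski_closure (@common_zero_tuples R m d b) =
  [set v | toric_solvable b (fun i j => v (mxvec_index i j))].
Proof.
move=> d_gt0; apply/seteqP; split=> v /= vP.
  apply: contrapT => not_solv.
  pose l (i : 'I_m.+1) (j : 'I_d) : {mpoly C[m.+1 * d]} := 'X_(mxvec_index i j).
  have lE (w : 'I_(m.+1 * d) -> C) :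
      (fun i j => (l i j).@[w]) = (fun i j => w (mxvec_index i j)).
    by apply: funext => i; apply: funext => j; rewrite mevalXU.
  have [|p nzp p0] := @toric_solvable_closed _ _ _ b _ _ l v; first by rewrite lE.
  case/eqP: nzp; apply: vP => _ [t [u nzu ut] <-]; apply: p0; rewrite lE.
  exists (fun j => monomial u (b j)); split.
  - exact: monomial_toric_cone.
  - by exists (Ordinal d_gt0); apply: monomial_neq0.
  - move=> i; rewrite -[RHS](ut i) leval_laurent_of.
    by apply: eq_bigr => j _; rewrite tuple_pointE.
move=> p p0; have [q [q0 qc]] := toric_solvable_deformation vP.
pose Q l := mxvec (\matrix_(i < m.+1, j < d) q i j) 0 l.
have QE c l : (Q l).[c] = tuple_point (fun i j => (q i j).[c]) l.
  by case/mxvec_indexP: l => i j; rewrite tuple_pointE /Q mxvecE mxE.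
(* [p] vanishes along the curve at nonzero parameters, hence identically; parameter 0 gives [v]. *)
have pQ0 : mmap polyC Q p = 0.
  apply: poly_eq0_closed => c nzc; rewrite horner_mmap; apply: p0.
  exists (fun i j => (q i j).[c]); last by apply: funext => l; rewrite QE.
  have [u nzu uq] := qc c nzc; exists u => // i.
  by rewrite leval_laurent_of.
rewrite /zero_locus /=; have := congr1 (fun r => r.[0]) pQ0.
rewrite horner_mmap horner0 => h; rewrite -[RHS]h; congr (_.@[_]).
apply: funext => l; rewrite QE; case/mxvec_indexP: l => i j.
by rewrite tuple_pointE q0.
Qed.

End Resultant.

Theorem proposition1p1 (R : realType) (k d : nat) (a : 'I_d -> 'rV[int]_k)
    (d_gt0 : (0 < d)%N) (a_inj : injective a) :
  let VA := discriminant_union R a in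
  VA = zariski_closure VA /\
  (forall E : {mpoly R[i][d]}, is_principal_A_determinant a E ->
     zariski_closure VA = zero_locus E).
Proof.
move=> VA; have closedVA : VA = zariski_closure VA.
  apply/seteqP; split=> alpha; first by move=> VAa p; apply.
  rewrite {2}/VA discriminant_unionE => cl_alpha; apply: contrapT => not_solv.
  (* [logcoef] is linear in alpha, so its values at the constant 1 are the coefficients of these
     linear forms. *)
  pose l i j : {mpoly R[i][d]} := logcoef a (fun=> 1) i j *: 'X_j.
  have lE (t : 'I_d -> R[i]) : (fun i j => (l i j).@[t]) = logcoef a t.
    apply: funext => i; apply: funext => j.
    by rewrite mevalZ mevalXU /logcoef mulr1.
  have [|p nzp p0] := @toric_solvable_closed _ _ _ a _ _ l alpha; first by rewrite lE.
  case/eqP: nzp; apply: cl_alpha => t; rewrite /VA discriminant_unionE /= -lE.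
  exact: p0.
split=> // E [m [b [r [ab [_ rE] EE]]]]; rewrite -closedVA.
have b_inj : injective b.
  have [M [c [_ _ phi_b]]] := ab.
  by move=> i j bij; apply: a_inj; rewrite -!phi_b bij.
have rP (v : 'I_(m.+1 * d) -> R[i]) :
    r.@[v] = 0 <-> toric_solvable b (fun i j => v (mxvec_index i j)).
  have -> : (r.@[v] = 0) = zero_locus r v by [].
  by rewrite rE closure_common_zero_tuples.
have EP alpha : E.@[alpha] = 0 <-> toric_solvable a (logcoef a alpha).
  rewrite EE rP (toric_solvable_lattice alpha ab).
  rewrite [X in toric_solvable b X](_ : _ = logcoef b alpha); first by [].
  apply: funext => i; apply: funext => j.
  by rewrite tuple_pointE coeff_log_derivatives.
by rewrite /VA discriminant_unionE; apply/seteqP; split=> alpha /EP.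
Qed.
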